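(* Assume the Continuum Hypothesis. Let $X$ be a compact Hausdorff $F$-space of weight $\mathfrak{c}$ and of finite covering dimension $\dim X = n$. Then there are a compact Hausdorff zero-dimensional space $Y$ of weight $\mathfrak{c}$ and a continuous surjection $f:Y\to X$ such that $|f^{-1}(x)|\le 2^n$ for all $x\in X$.
   Context: $\mathfrak{c}=2^{\aleph_0}$. A space is an $F$-space if separated $F_\sigma$-sets in it have disjoint closures, where $A$ and $B$ are separated if $A\cap\overline{B}=\emptyset=\overline{A}\cap B$. The weight of a space is the minimal cardinality of a base. Covering dimension: $\dim X\le n$ iff every finite open cover of the normal space $X$ has an open refinement in which every point of $X$ lies in at most $n+1$ members; $\dim\emptyset=-1$. *)

(* Defs.v *)
From mathcomp Require Import all_boot.
From mathcomp Require Import boolp classical_sets functions cardinality.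
From mathcomp Require Import topology borel_hierarchy.

Set Implicit Arguments.
Unset Strict Implicit.
Unset Printing Implicit Defensive.

Local Open Scope classical_set_scope.
Local Open Scope card_scope.

(* Cardinals are represented by sets up to [#=]. *)
Definition continuum : set (set nat) := [set: set nat].

Definition continuum_hypothesis : Prop :=
  forall A : set (set nat), countable A \/ A #= continuum.

Definition F_space (X : topologicalType) : Prop :=
  forall A B : set X, Fsigma A -> Fsigma B -> separated A B ->
    closure A `&` closure B = set0.

Definition has_weight (X : topologicalType) (T : Type) (K : set T) : Prop :=
  (exists2 B : set (set X), basis B & B #= K) /\
  (forall B : set (set X), basis B -> K #<= B).

Definition is_open_cover (X : topologicalType) (U : set (set X)) : Prop :=
  U `<=` open /\ \bigcup_(A in U) A = [set: X].

Definition refines (X : Type) (V U : set (set X)) : Prop :=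
  forall A, V A -> exists2 B, U B & A `<=` B.

Definition covdim_le (X : topologicalType) (n : nat) : Prop :=
  forall U : set (set X), finite_set U -> is_open_cover U ->
    exists V : set (set X),
      [/\ is_open_cover V, refines V U &
          forall x : X, [set A | V A /\ A x] #<= `I_n.+1].

(* Nonemptiness is required since the empty space, of dimension -1, satisfies
   [covdim_le 0]. *)
Definition has_covdim (X : topologicalType) (n : nat) : Prop :=
  [/\ [set: X] !=set0, covdim_le X n &
      forall m, (m < n)%N -> ~ covdim_le X m].

(* MathComp-Analysis' [zero_dimensional] only asks that points be separated by
   clopen sets, i.e. total separatedness.  On compact Hausdorff spaces the two
   notions agree (for nonempty spaces). *)
Definition covdim_zero (X : topologicalType) : Prop := has_covdim X 0.

(* Main.v *)
Require Import Defs.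
From Stdlib Require Import Wellfounded.
From mathcomp Require Import all_boot.
From mathcomp Require Import mathcomp_extra boolp classical_sets functions.
From mathcomp Require Import cardinality wochoice.
From mathcomp Require Import topology borel_hierarchy.

Set Implicit Arguments.
Unset Strict Implicit.
Unset Printing Implicit Defensive.

Local Open Scope classical_set_scope.
Local Open Scope card_scope.

(** By well-ordering the continuum in type omega_1, we build a family of
   partitions [L_j = X \ (U_j ∪ V_j)], [U_j] and [V_j] disjoint open, which
   separates the points of [X] and of which any [n+1] distinct members have empty
   intersection.  All pairs [(U_j, V_j)] grow simultaneously through open
   F-sigma sets.  At each step one [(n+1)]-tuple of pairs is enlarged so that its
   partitions no longer meet, which [dim X <= n] allows as soon as the closures
   of [U_j] and [V_j] are disjoint.  At limits we take unions; under CH these are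
   countable, so they are still F-sigma, and the F-space property makes the
   closures disjoint again.  Then
     [Y = {(x, s) in X * 2^J | s_j selects a closed half of L_j containing x}]
   is zero-dimensional, since the coordinates [s_j] separate its points, and
   the fibre over [x] has at most [2^n] points, because [x] lies in at most [n]
   of the [L_j]. *)

(** * Sets of natural numbers *)

(** Through the pairing [pickle], one set of naturals carries a whole sequence of them, so [set nat]
    can index pairs of basic sets, tuples of partitions and boxes alike. *)
Definition decode (a : set nat) (k : nat) : set nat :=
  [set m | a (pickle (k, m))].

Lemma decode_surj (f : nat -> set nat) : exists a, decode a = f.
Proof.
exists [set p | if unpickle p is Some (k, m) then f k m else False].
by apply/funext => k; apply/seteqP; split=> m; rewrite /decode /= pickleK.
Qed.

Lemma uncountable_continuum : ~ countable continuum.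
Proof.
move=> /countable_injP[f finj].
pose D : set nat := [set m | exists2 a : set nat, f a = m & ~ a m].
have [Df|nDf] := pselect (D (f D)); last by apply: (nDf); exists D.
have [a fa na] := Df; apply: na.
by rewrite (finj a D _ _ fa) ?inE.
Qed.

Lemma strict_well_order (T : eqType) : exists lt : T -> T -> Prop,
  well_founded lt /\ forall x y, [\/ lt x y, x = y | lt y x].
Proof.
have [R Rwo] := well_ordering_principle T.
have min (A : set T) : A !=set0 -> exists2 z, A z & forall x, A x -> R z x.
  move=> [a Aa]; have [|z [[Az zA] _]] := Rwo [pred x | `[< A x >]].
    by exists a; exact: asboolT.
  exists z; first exact: asboolW Az.
  by move=> x Ax; apply: zA; exact: asboolT.
have Rtot x y : R x y \/ R y x.
  have [|z [->|->] zle] := min [set x; y]; first by exists x; left.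
    by left; apply: zle; right.
  by right; apply: zle; left.
(* Minima in a well-order are unique, and here both [x] and [y] are minima of their pair. *)
have Ranti x y : R x y -> R y x -> x = y.
  move=> xy yx.
  have Rxx z : R z z by case: (Rtot z z).
  have [|z [_ zu]] := Rwo [pred z | (z == x) || (z == y)].
    by exists x; rewrite inE eqxx.
  rewrite -(zu x) ?(zu y)//.
  - split; first by rewrite inE eqxx orbT.
    by move=> t; rewrite inE => /orP[/eqP->|/eqP->].
  - split; first by rewrite inE eqxx.
    by move=> t; rewrite inE => /orP[/eqP->|/eqP->].
exists (fun x y => R x y /\ x <> y); split.
- move=> x; apply: contrapT => nx.
  have [|z nz zle] := min [set x | ~ Acc (fun x y => R x y /\ x <> y) x].
    by exists x.
  apply: nz; constructor => y [yz neq]; apply: contrapT => /zle zy.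
  by apply: neq; exact: Ranti.
- move=> x y; have [->|/eqP nxy] := eqVneq x y; first by constructor 2.
  by case: (Rtot x y) => ?; [constructor 1|constructor 3; split => // /esym].
Qed.

(** If some initial segment is uncountable, take the least [x] with that property. Under CH the
    segment below [x] has size continuum, and pulling the order back along an injection into it
    makes all segments countable. *)
Lemma continuum_order : continuum_hypothesis ->
  exists lt : set nat -> set nat -> Prop,
  [/\ well_founded lt, forall a b, [\/ lt a b, a = b | lt b a] &
      forall a, countable [set b | lt b a]].
Proof.
move=> CH; have [lt [ltwf lttot]] := strict_well_order (set nat).
have seg_image phi a : injective phi -> countable [set b | lt b (phi a)] ->
    countable [set b | lt (phi b) (phi a)].
  move=> phiinj; apply: sub_countable.
  have /card_esym/card_eqPle[+ _] : phi @` [set b | lt (phi b) (phi a)] #=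
      [set b | lt (phi b) (phi a)] by apply: inj_card_eq => x y _ _ /phiinj.
  by move=> /card_le_trans; apply; apply: subset_card_le => _ [b ltb <-].
suff [phi phiinj phic] : exists2 phi : set nat -> set nat, injective phi &
    forall a, countable [set b | lt b (phi a)].
  exists (fun a b => lt (phi a) (phi b)); split.
  - exact: (wf_inverse_image _ _ lt phi ltwf).
  - move=> a b; case: (lttot (phi a) (phi b)); [by constructor 1| |by constructor 3].
    by move=> /phiinj->; constructor 2.
  - by move=> a; exact: seg_image.
have [seg|/existsNP[x0 x0P]] := pselect (forall a, countable [set b | lt b a]).
  by exists id.
have [x [xP xmin]] : exists x, ~ countable [set b | lt b x] /\
    forall y, lt y x -> countable [set b | lt b y].
  elim/(well_founded_ind ltwf): x0 x0P => y IH yP.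
  have [ymin|/existsNP[z /not_implyP[zy zP]]] :=
    pselect (forall z, lt z y -> countable [set b | lt b z]).
    by exists y.
  exact: (IH z).
have [//|/card_esym/card_eqPle[/pcard_leP/injfunPex[phi phiD phiinj] _]] :=
  CH [set b | lt b x].
exists phi; first by move=> a b; apply: phiinj; rewrite inE.
by move=> a; apply: xmin; exact: phiD.
Qed.

(** * Partitions in normal spaces *)

(** Without a finite subcover, the complements in [A] of finite unions generate a proper filter. A
    member of [U] around one of its cluster points gives a contradiction. *)
Lemma finite_subcover (T : topologicalType) (A : set T) (U : set (set T)) :
  compact A -> U `<=` open -> A `<=` \bigcup_(B in U) B ->
  exists V, [/\ finite_set V, V `<=` U & A `<=` \bigcup_(B in V) B].
Proof.
move=> cA oU AU; apply: contrapT => nV.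
pose F : set_system T := [set B | exists V,
  [/\ finite_set V, V `<=` U & A `\` \bigcup_(C in V) C `<=` B]].
have FF : Filter F.
  split.
  - by exists set0; split => //; exact: finite_set0.
  - move=> B C [V [fV VU VB]] [W [fW WU WC]]; exists (V `|` W); split.
    + by rewrite finite_setU.
    + by rewrite subUset.
    + rewrite bigcup_setU => x [Ax nx]; split.
        by apply: VB; split=> // ?; apply: nx; left.
      by apply: WC; split=> // ?; apply: nx; right.
  - by move=> B C BC [V [fV VU VB]]; exists V; split=> //; exact: subset_trans BC.
have PF : ProperFilter F.
  split=> // -[V [fV VU V0]]; apply: nV; exists V; split=> // x Ax.
  by apply: contrapT => nx; apply: (V0 x).
have FA : F A by exists set0; split=> [|//|x []//]; exact: finite_set0.
have [p [Ap pF]] := cA F PF FA.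
have [B UB Bp] := AU _ Ap.
have [|q [[Aq nq] Bq]] := pF (A `\` B) B _ (open_nbhs_nbhs (conj (oU _ UB) Bp)).
  exists [set B]; split; [exact: finite_set1|by move=> _ ->|].
  by rewrite bigcup_set1.
exact: nq.
Qed.

Lemma open_seq_bigcap (T : topologicalType) (I : eqType) (s : seq I) (F : I -> set T) :
  (forall i, i \in s -> open (F i)) -> open [set x | forall i, i \in s -> F i x].
Proof.
elim: s => [_|i s IH oF].
  by rewrite (_ : [set x | _] = setT); [exact: openT|apply/seteqP; split].
rewrite (_ : [set x | _] = F i `&` [set x | forall j, j \in s -> F j x]).
  apply: openI; first by apply: oF; rewrite inE eqxx.
  by apply: IH => j js; apply: oF; rewrite inE js orbT.
apply/seteqP; split=> x.
  move=> xF; split=> /=; first by apply: xF; rewrite inE eqxx.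
  by move=> j js; apply: xF; rewrite inE js orbT.
by move=> [xi xs] j; rewrite inE => /orP[/eqP->//|]; exact: xs.
Qed.

Section Normal.
Variable T : topologicalType.
Hypothesis Tnormal : normal_space T.
Implicit Types A B O U V Z : set T.

Lemma normal_shrink A O : closed A -> open O -> A `<=` O ->
  exists W, [/\ open W, A `<=` W & closure W `<=` O].
Proof.
move=> cA oO AO; have nAO : set_nbhs A O by apply/set_nbhsP; exists O; split.
have [W /set_nbhsP[V [oV AV VW]] WO] := Tnormal cA nAO.
by exists V; split=> //; exact: subset_trans (closureS VW) WO.
Qed.

Definition open_Fsigma U := open U /\ Fsigma U.

(** Iterated shrinking inside [O] interleaves the closed sets [c k] with the open sets [s (c k)], so
    their common union is at once open and F-sigma. *)
Lemma normal_open_Fsigma A O : closed A -> open O -> A `<=` O ->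
  exists W, [/\ open_Fsigma W, A `<=` W & W `<=` O].
Proof.
move=> cA oO AO.
have /choice[s sP] : forall C, exists W, closed C -> C `<=` O ->
    [/\ open W, C `<=` W & closure W `<=` O].
  move=> C; have [[cC CO]|nC] := pselect (closed C /\ C `<=` O).
    by have [W WP] := normal_shrink cC oO CO; exists W.
  by exists set0 => cC CO; exfalso; apply: nC.
pose c k := iter k (fun C => closure (s C)) A.
have cP k : closed (c k) /\ c k `<=` O.
  elim: k => [//|k [ck kO]] /=; split; first exact: closed_closure.
  by have [_ _] := sP _ ck kO.
exists (\bigcup_k c k); split; last by move=> x [k _ /(proj2 (cP k))].
- split; last by exists c => // k; case: (cP k).
  rewrite (_ : \bigcup_k c k = \bigcup_k s (c k)).
    by apply: bigcup_open => k _; have [] := sP _ (proj1 (cP k)) (proj2 (cP k)).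
  apply/seteqP; split=> x [k _ xk].
    by exists k => //; have [_ + _] := sP _ (proj1 (cP k)) (proj2 (cP k)); exact.
  by exists k.+1 => //=; exact: subset_closure.
- by move=> x Ax; exists 0.
Qed.

Lemma normal_separation A B : closed A -> closed B -> A `&` B = set0 ->
  exists P : set T * set T,
    [/\ open_Fsigma P.1, open_Fsigma P.2, P.1 `&` P.2 = set0, A `<=` P.1 & B `<=` P.2].
Proof.
move=> cA cB /disjoints_subset AB.
have [W [oW AW WB]] := normal_shrink cA (closed_openC cB) AB.
have [U [UF AU UW]] := normal_open_Fsigma cA oW AW.
have [|V [VF BV VW]] := normal_open_Fsigma cB (closed_openC (@closed_closure _ W)).
  by move=> x Bx /WB; exact.
exists (U, V); split=> //=; apply/disjoints_subset => x /UW Wx /VW; apply.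
exact: subset_closure.
Qed.

(** With duplicate-free lists, failure means that more than [k] members of [V] share the point [x],
    an open condition when the members are open. *)
Definition order_le (V : set (set T)) k x :=
  forall s : seq (set T), uniq s -> (forall A, A \in s -> V A /\ A x) -> (size s <= k)%N.


Lemma closed_order_le (V : set (set T)) k : V `<=` open -> closed (order_le V k).
Proof.
move=> oV; rewrite -openC.
rewrite (_ : ~` _ = \bigcup_(s in [set s : seq (set T) |
    [/\ uniq s, (k < size s)%N & forall A, A \in s -> V A]])
    [set x | forall A, A \in s -> A x]).
  by apply: bigcup_open => s [_ _ sV]; apply: open_seq_bigcap => A /sV/oV.
apply/seteqP; split=> x.
  move=> /existsNP[s /not_implyP[us /not_implyP[sV /negP]]].
  by rewrite -ltnNge => ks; exists s => [|A /sV[]//]; split=> // A /sV[].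
move=> [s [us ks sV] sx] /(_ s us); rewrite leqNgt ks => absurd.
by apply: notF; apply: absurd => A As; split; [exact: sV|exact: sx].
Qed.

(** Induction on [k]: the first [k] pairs cover the points of order at most [k]. The closed rest [E]
    splits into two relatively clopen parts, according to whether a point lies in a member of [V]
    meeting [F k]. The new pair absorbs one part in each half, which is possible because [V] covers
    and no member of it meets both [F k] and [G k]. *)
Lemma partition_of_order (V : set (set T)) (F G : nat -> set T) :
    V `<=` open -> (forall x, (\bigcup_(A in V) A) x) ->
    (forall i, closed (F i)) -> (forall i, closed (G i)) ->
    (forall i, F i `&` G i = set0) ->
    forall k Z,
    (forall A i, V A -> (i < k)%N -> A `&` F i = set0 \/ A `&` G i = set0) ->
    closed Z -> Z `<=` order_le V k ->
  exists P : nat -> set T * set T,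
    (forall i, [/\ open_Fsigma (P i).1, open_Fsigma (P i).2,
       (P i).1 `&` (P i).2 = set0, F i `<=` (P i).1 & G i `<=` (P i).2]) /\
    forall x, Z x -> exists2 i, (i < k)%N & ((P i).1 `|` (P i).2) x.
Proof.
move=> oV coverV cF cG FG; elim=> [|k IH] Z VFG cZ Zk.
  have /choice[P PP] i := normal_separation (cF i) (cG i) (FG i).
  (* As [V] covers, no point has order 0, so [Z] is empty. *)
  exists P; split=> // x Zx; have [A VA Ax] := coverV x.
  have := Zk x Zx [:: A] isT; rewrite ltn0 => /(_ _)/notF[] // B.
  by rewrite inE => /eqP->.
have [|||P [PP PZ]] := IH (Z `&` order_le V k).
- by move=> A i VA ik; apply: VFG => //; exact: ltnW.
- by apply: closedI => //; exact: closed_order_le.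
- by move=> x [].
pose O := \bigcup_(i in `I_k) ((P i).1 `|` (P i).2).
have oO : open O.
  by apply: bigcup_open => i _; have [[? _] [? _] _ _ _] := PP i; exact: openU.
pose E := Z `\` O.
have cE : closed E by apply: closedI => //; exact: open_closedC.
(* Points of order at most [k] are covered by [O], so a point of [E] lies in more than [k] members,
   of which [k.+1] are kept. *)
have Ewitness x : E x -> exists s, [/\ uniq s, size s = k.+1 &
    forall A, A \in s -> V A /\ A x].
  move=> [Zx nOx]; apply: contrapT => ns; apply: nOx.
  suff xk : order_le V k x by have [i] := PZ x (conj Zx xk); exists i.
  move=> s us sVx; rewrite leqNgt; apply/negP => ks; apply: ns.
  exists (take k.+1 s); split; first exact: take_uniq.
    by rewrite size_takel.
  by move=> A /mem_take; exact: sVx.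
pose meets := [set x | exists A, [/\ V A, A x & A `&` F k !=set0]].
have omeets : open meets.
  rewrite (_ : meets = \bigcup_(A in [set A | V A /\ A `&` F k !=set0]) A).
    by apply: bigcup_open => A [/oV].
  apply/seteqP; split=> x; first by move=> [A [VA Ax AF]]; exists A.
  by move=> [A [VA AF] Ax]; exists A.
pose E0 := E `&` ~` meets.
have cE0 : closed E0 by apply: closedI => //; exact: open_closedC.
(* On [E] every point lies in exactly [k.+1] members of [V], so that the set
   of members containing a point is locally constant. *)
have [N [oN EN]] : exists N, open N /\ E `\` meets = E `&` N.
  exists (\bigcup_(s in [set s : seq (set T) | [/\ uniq s, size s = k.+1 &
    forall A, A \in s -> V A /\ A `&` F k = set0]]) [set x | forall A, A \in s -> A x]).
  split.
    by apply: bigcup_open => s [_ _ sV]; apply: open_seq_bigcap => A /sV[/oV].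
  apply/seteqP; split=> x [Ex].
    move=> nx; split=> //; have [s [us ss sVx]] := Ewitness x Ex.
    exists s => [|A /sVx[]//]; split=> // A /sVx[VA Ax]; split=> //.
    by apply: contrapT => /eqP/set0P AF; apply: nx; exists A.
  move=> [s [us ss sV] sx]; split=> // -[A [VA Ax AF]].
  (* The members in [s] miss [F k] while [A] meets it, so [A] would be one member too many through
     [x]. *)
  have As : A \notin s.
    by apply/negP => /sV[_ AF0]; move: AF; rewrite AF0 => -[].
  have := Zk x (proj1 Ex) (A :: s); rewrite /= As us ss ltnn => /(_ isT) absurd.
  apply: notF; apply: absurd => B; rewrite inE => /orP[/eqP->//|Bs].
  by have [VB _] := sV B Bs; split=> //; exact: sx.
have cE1 : closed (E `&` meets).
  rewrite (_ : E `&` meets = E `&` ~` N).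
    by apply: closedI => //; exact: open_closedC.
  apply/seteqP; split=> x [Ex xM]; split=> //.
    by move=> Nx; have [] : (E `\` meets) x by rewrite EN.
  by apply: contrapT => nx; apply: xM; have [] : (E `&` N) x by rewrite -EN.
have cE2 : closed (E `\` meets) by apply: closedI => //; exact: open_closedC.
have [|||Q [Q1 Q2 Q12 QF QG]] :=
  @normal_separation (F k `|` (E `&` meets)) (G k `|` (E `\` meets)).
- exact: closedU.
- exact: closedU.
- apply/disjoints_subset => x [Fx|[Ex [A [VA Ax AF]]]] [Gx|[E'x nx]].
  + by have : (F k `&` G k) x by []; rewrite FG.
  + apply: nx; have [A VA Ax] := coverV x; exists A; split=> //.
    by exists x.
  + have [AF0|AG0] := VFG A k VA (ltnSn k); first by move: AF; rewrite AF0 => -[].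
    by have : (A `&` G k) x by []; rewrite AG0.
  + by apply: nx; exists A.
exists (fun i => if i == k then Q else P i); split.
  move=> i; case: eqP => [->|_]; last exact: PP.
  split=> //.
    by apply: subset_trans QF => x; left.
  by apply: subset_trans QG => x; left.
move=> x Zx; have [[i ik xi]|nOx] := pselect (O x).
  by exists i; [exact: ltnW|rewrite (ltn_eqF ik)].
exists k => //; rewrite eqxx; have Ex : E x by [].
have [xm|nxm] := pselect (meets x).
  by left; apply: QF; right.
by right; apply: QG; right.
Qed.

End Normal.

Lemma order_le_card (T : topologicalType) (V : set (set T)) k x :
  [set A | V A /\ A x] #<= `I_k -> order_le V k x.
Proof.
move=> Vk s us sV; rewrite -card_le_II.
have /card_eqPle[_ sI] : nth set0 s @` `I_(size s) #= `I_(size s).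
  by apply: inj_card_eq => i j; rewrite !inE /= => /uniqP; apply.
apply: card_le_trans sI (card_le_trans _ Vk); apply: subset_card_le.
by move=> _ [i si <-]; apply: sV; exact: mem_nth.
Qed.

(** The sets [W e] avoid one set from each of the first [n.+1] pairs, and they cover because [F i]
    and [G i] are disjoint. A refinement of order at most [n.+1] is then exactly what
    [partition_of_order] asks for. *)
Lemma covdim_partition (T : topologicalType) n (F G : nat -> set T) :
    normal_space T -> covdim_le T n ->
    (forall i, closed (F i)) -> (forall i, closed (G i)) ->
    (forall i, F i `&` G i = set0) ->
  exists P : nat -> set T * set T,
    (forall i, [/\ open_Fsigma (P i).1, open_Fsigma (P i).2,
       (P i).1 `&` (P i).2 = set0, F i `<=` (P i).1 & G i `<=` (P i).2]) /\
    forall x, exists2 i, (i <= n)%N & ((P i).1 `|` (P i).2) x.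
Proof.
move=> Tn dimT cF cG FG.
pose W (e : {ffun 'I_n.+1 -> bool}) : set T :=
  [set x | forall i, i \in enum 'I_n.+1 -> (~` (if e i then F i else G i)) x].
have oW e : open (W e).
  by apply: open_seq_bigcap => i _; apply: closed_openC; case: (e i).
have [||V [[oV VT] VW Vn]] := dimT (range W).
- exact: finite_image.
- split; first by move=> _ [e _ <-].
  apply/seteqP; split=> // x _.
  pose e := [ffun i : 'I_n.+1 => `[< ~ F i x >]].
  exists (W e); first by exists e.
  move=> i _; rewrite ffunE; case: asboolP => // /contrapT Fx Gx.
  by have : (F i `&` G i) x by []; rewrite FG.
have [||||P [PP PT]] := @partition_of_order _ Tn V F G oV _ cF cG FG n.+1 setT.
- by move=> x; rewrite VT.
- move=> A i VA ik; have [_ [e _ <-] AW] := VW A VA.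
  have := fun x Ax => AW x Ax (Ordinal ik) (mem_enum _ _);
    case: (e _) => /= AFG; [left|right];
    by apply/disjoints_subset => x /AFG.
- exact: closedT.
- by move=> x _; apply: order_le_card; exact: Vn.
exists P; split=> // x; have [i ik xi] := PT x I; by exists i.
Qed.

(** * The transfinite construction *)

(** The step [F] takes a total function, so [s0] fills in the values outside the segment below [i].
    Extensionality makes [F] blind to them. *)
Lemma well_founded_recursion (Idx S : Type) (lt : Idx -> Idx -> Prop) (s0 : S)
    (F : Idx -> (Idx -> S) -> S) : well_founded lt ->
  (forall i g h, (forall j, lt j i -> g j = h j) -> F i g = F i h) ->
  exists f, forall i, f i = F i f.
Proof.
move=> ltwf Fext.
pose extend i (rec : forall j, lt j i -> S) j :=
  if pselect (lt j i) is left ji then rec j ji else s0.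
pose f := Fix ltwf (fun _ => S) (fun i rec => F i (extend i rec)).
exists f => i; rewrite /f Fix_eq.
  by apply: Fext => j ji; rewrite /extend; case: pselect.
move=> j g h gh; congr F; apply/funext => k.
by rewrite /extend; case: pselect.
Qed.

Lemma Fsigma_bigcup (T : topologicalType) (Idx : Type) (D : set Idx) (A : Idx -> set T) :
  countable D -> (forall i, D i -> Fsigma (A i)) -> Fsigma (\bigcup_(i in D) A i).
Proof.
move=> /pfcard_geP[->|[g]] FA.
  by rewrite bigcup_set0; apply: closed_Fsigma; exact: closed0.
have /choice[K KP] k : exists K : nat -> set T,
    (forall i, closed (K i)) /\ A (g k) = \bigcup_i K i.
  by have [K cK AK] := FA (g k) (funS k I); exists K.
exists (fun m => if unpickle m is Some (k, i) then K k i else set0).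
  move=> m; case: (unpickle m) => [[k i]|]; last exact: closed0.
  by have [+ _] := KP k; exact.
apply/seteqP; split=> x.
  move=> [i Di]; have [k _ <-] := surj (f := g) Di.
  rewrite (proj2 (KP k)) => -[j _ xj].
  by exists (pickle (k, j)) => //; rewrite pickleK.
move=> [m _]; case: (unpickle m) => [[k i]|//] xi.
by exists (g k); [exact: funS|rewrite (proj2 (KP k)); exists i].
Qed.

Section Separations.
Variable X : topologicalType.
Implicit Types P Q : set X * set X.

Definition separation P :=
  [/\ open_Fsigma P.1, open_Fsigma P.2 & P.1 `&` P.2 = set0].

Definition separation_le P Q := P.1 `<=` Q.1 /\ P.2 `<=` Q.2.

(** Each half is open and disjoint from the other, hence misses its closure, so the two halves are
    separated F-sigma sets. *)
Lemma separation_closure P : F_space X -> separation P ->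
  closure P.1 `&` closure P.2 = set0.
Proof.
move=> XF [[oP1 F1] [oP2 F2] P0]; apply: XF => //; split.
  apply/disjoints_subset => x clx Px; have := clx _ (open_nbhs_nbhs (conj oP2 Px)).
  by rewrite P0 => -[].
apply/disjoints_subset => x Px clx; have := clx _ (open_nbhs_nbhs (conj oP1 Px)).
by rewrite setIC P0 => -[].
Qed.

Lemma separation_bigcup (Idx : Type) (D : set Idx) (S : Idx -> set X * set X) :
  countable D -> (forall i, D i -> separation (S i)) ->
  (forall i j, D i -> D j -> separation_le (S i) (S j) \/ separation_le (S j) (S i)) ->
  separation (\bigcup_(i in D) (S i).1, \bigcup_(i in D) (S i).2).
Proof.
move=> cD sepS chainS; split=> /=.
- split; first by apply: bigcup_open => i /sepS[[]].
  by apply: Fsigma_bigcup => // i /sepS[[]].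
- split; first by apply: bigcup_open => i /sepS[_ []].
  by apply: Fsigma_bigcup => // i /sepS[_ []].
- apply/disjoints_subset => x [i Di xi] [j Dj xj].
  have [[S1 _]|[_ S2]] := chainS i j Di Dj.
    have [_ _ S0] := sepS j Dj.
    have : ((S j).1 `&` (S j).2) x by split=> //; exact: S1.
    by rewrite S0.
  have [_ _ S0] := sepS i Di.
  have : ((S i).1 `&` (S i).2) x by split=> //; exact: S2.
  by rewrite S0.
Qed.

Variable n : nat.
Hypothesis Xnormal : normal_space X.
Hypothesis XF : F_space X.
Hypothesis Xdim : covdim_le X n.
Variable J : Type.
Implicit Types S : J -> set X * set X.

Lemma separation_enlarge S (a : nat -> J) :
  (forall j, separation (S j)) -> {in `I_n.+1 &, injective a} ->
  exists S', [/\ forall j, separation (S' j), forall j, separation_le (S j) (S' j) &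
    forall x, exists2 i, (i <= n)%N & ((S' (a i)).1 `|` (S' (a i)).2) x].
Proof.
move=> sepS ainj.
have [|||P [PP Pcover]] := covdim_partition (F := fun i => closure (S (a i)).1)
    (G := fun i => closure (S (a i)).2) Xnormal Xdim.
- by move=> i; exact: closed_closure.
- by move=> i; exact: closed_closure.
- by move=> i; exact: separation_closure.
(* By injectivity [b] inverts [a] on [0..n]. Elsewhere its default value is discarded by the test
   [a (b j) = j] below. *)
have /choice[b bP] j : exists b : nat,
    forall i, (i <= n)%N -> a i = j -> b = i /\ a b = j.
  have [[i [ile aij]]|ni] := pselect (exists i, (i <= n)%N /\ a i = j).
    exists i => k kle akj; split=> //.
    by apply: ainj; rewrite ?inE// aij akj.
  by exists 0 => i ile aij; exfalso; apply: ni; exists i.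
exists (fun j => if `[< (b j <= n)%N /\ a (b j) = j >] then P (b j) else S j); split.
- move=> j; case: asboolP => // _.
  by have [? ? ? _ _] := PP (b j); split.
- move=> j; case: asboolP => [[_ abj]|_]; last by split.
  have [_ _ _] := PP (b j); rewrite abj => P1 P2.
  by split; [apply: subset_trans P1|apply: subset_trans P2]; exact: subset_closure.
- move=> x; have [i ile xi] := Pcover x; exists i => //.
  have [-> _] := bP (a i) i ile erefl.
  by rewrite asboolT.
Qed.

Variables (Idx : Type) (lt : Idx -> Idx -> Prop) (task : Idx -> nat -> J).
Hypothesis ltwf : well_founded lt.
Hypothesis lt_total : forall i j, [\/ lt i j, i = j | lt j i].
Hypothesis lt_countable : forall i, countable [set j | lt j i].

(** Stage [i] unites the earlier stages, a countable chain, so the pairs stay open F-sigma; then it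
    carries out task [i] by [separation_enlarge]. Pairs only grow, so what a stage has covered stays
    covered. The union over all stages may be uncountable and is only claimed to be open and
    disjoint. *)
Lemma open_pairs_of_small_order S0 : (forall j, separation (S0 j)) ->
  exists S, [/\ forall j, [/\ open (S j).1, open (S j).2 & (S j).1 `&` (S j).2 = set0],
    forall j, separation_le (S0 j) (S j) &
    forall i, {in `I_n.+1 &, injective (task i)} ->
      forall x, exists2 k, (k <= n)%N & ((S (task i k)).1 `|` (S (task i k)).2) x].
Proof.
move=> sepS0.
have /choice[next nextP] (q : Idx * (J -> set X * set X)) : exists S',
    (forall j, separation (q.2 j)) -> [/\ forall j, separation (S' j),
      forall j, separation_le (q.2 j) (S' j) &
      {in `I_n.+1 &, injective (task q.1)} ->
      forall x, exists2 k, (k <= n)%N &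
        ((S' (task q.1 k)).1 `|` (S' (task q.1 k)).2) x].
  case: q => i S /=; have [sepS|nsep] := pselect (forall j, separation (S j)); last first.
    by exists S => /nsep.
  have [inj|ninj] := pselect {in `I_n.+1 &, injective (task i)}.
    by have [S' [? ? ?]] := separation_enlarge sepS inj; exists S'; split.
  by exists S => _; split=> // j; split.
(* [None] stands for the initial family [S0] and lies below every stage. *)
pose below i : set (option Idx) := [set o | if o is Some j then lt j i else True].
pose value (f : Idx -> J -> set X * set X) o j := if o is Some i then f i j else S0 j.
pose union (f : Idx -> J -> set X * set X) (D : set (option Idx)) j :=
  (\bigcup_(o in D) (value f o j).1, \bigcup_(o in D) (value f o j).2).
have [|f fE] := @well_founded_recursion Idx _ lt S0
    (fun i f => next (i, union f (below i))) ltwf.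
  move=> i g h gh; congr (next (i, _)); apply/funext => j.
  by congr pair; apply: eq_bigcupr => -[k /= /gh->|].
have below_countable i : countable (below i).
  rewrite (_ : below i = None |` Some @` [set j | lt j i]).
    rewrite -bigcup2E; apply: bigcup_countable => // -[|[|k]] _ /=.
    - exact: countable1.
    - exact: sub_countable (card_image_le _ _) (lt_countable i).
    - exact: countable0.
  apply/seteqP; split=> [[j /= ji|_]|o [->//|[j ji <-]//]]; last by left.
  by right; exists j.
have value_le i o j : below i o -> separation_le (value f o j) (union f (below i) j).
  by move=> io; split=> x xo; exists o.
have fP i : (forall j, separation (union f (below i) j)) /\
    (forall j, separation (f i j)).
  elim/(well_founded_ind ltwf): i => i IH.
  have sepU j : separation (union f (below i) j).
    apply: separation_bigcup => //.
      by move=> [k /= /IH[_ +]|_]; [exact|exact: sepS0].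
    (* Stage [k] contains the union of everything below it. Hence the stages below [i] form the
       chain that [separation_bigcup] requires. *)
    have le_value o k : below i (Some k) -> below k o ->
        separation_le (value f o j) (value f (Some k) j).
      move=> ki ko; have [sepk _] := IH k ki.
      have [_ /(_ j) [U1 U2] _] := nextP (k, union f (below k)) sepk.
      have [V1 V2] := value_le k o j ko.
      by rewrite /= fE; split; apply: subset_trans; eassumption.
    move=> [k|] [l|] ki li.
    - have [kl|->|lk] := lt_total k l.
      + by left; exact: le_value.
      + by left; split.
      + by right; exact: le_value.
    - by right; exact: le_value.
    - by left; exact: le_value.
    - by left; split.
  by split=> // j; have [+ _ _] := nextP (i, union f (below i)) sepU; rewrite -fE.
have le_f i o j : below i o -> separation_le (value f o j) (f i j).
  move=> io; have [sepU _] := fP i.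
  have [_ /(_ j) [U1 U2] _] := nextP (i, union f (below i)) sepU.
  have [V1 V2] := value_le i o j io.
  by rewrite fE; split; apply: subset_trans; eassumption.
exists (union f setT); split.
- move=> j; split.
  + apply: bigcup_open => -[i|] _ /=.
    * by have [_ /(_ j)[[]]] := fP i.
    * by have [[]] := sepS0 j.
  + apply: bigcup_open => -[i|] _ /=.
    * by have [_ /(_ j)[_ []]] := fP i.
    * by have [_ []] := sepS0 j.
  + have sepv o : separation (value f o j).
      by case: o => [i|]; [exact: (proj2 (fP i) j)|exact: sepS0].
    have disj o (x : X) : (value f o j).1 x -> (value f o j).2 x -> False.
      by move=> x1 x2; have [_ _ /disjoints_subset/(_ x x1)] := sepv o.
    apply/disjoints_subset => x [o _ xo] [p _ xp].
    have [|] : separation_le (value f o j) (value f p j) \/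
        separation_le (value f p j) (value f o j).
      case: o p {xo xp} => [k|] [l|].
      * have [kl|->|lk] := lt_total k l.
        - by left; exact: (le_f l (Some k) j kl).
        - by left; split.
        - by right; exact: (le_f k (Some l) j lk).
      * by right; exact: (le_f k None j Logic.I).
      * by left; exact: (le_f l None j Logic.I).
      * by left; split.
    + by move=> [le1 _]; apply: (disj p x) => //; exact: le1.
    + by move=> [_ le2]; apply: (disj o x) => //; exact: le2.
- by move=> j; split=> x xj; exists None.
- move=> i inj x; have [sepU _] := fP i.
  have [_ _ /(_ inj x)[k kn xk]] := nextP (i, union f (below i)) sepU.
  exists k => //; move: xk; rewrite -(fE i) /= => -[xk|xk].
    by left; exists (Some i).
  by right; exists (Some i).
Qed.
End Separations.

(** * Zero-dimensionality and weight *)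

Lemma basisP (T : topologicalType) (B : set (set T)) :
  basis B <-> B `<=` open /\
    forall x U, open U -> U x -> exists O, [/\ B O, O x & O `<=` U].
Proof.
split=> -[oB Bx]; split=> // x.
  move=> U oU Ux; have [O [BO Ox] OU] := Bx x U (open_nbhs_nbhs (conj oU Ux)).
  by exists O.
move=> U; rewrite /= nbhsE => -[V [oV Vx] VU].
by have [O [BO Ox OV]] := Bx x V oV Vx; exists O => //; exact: subset_trans VU.
Qed.

Lemma compact_set_type (T : topologicalType) (A : set T) :
  compact A -> compact [set: A].
Proof.
move=> cA F FF _; have FA : F (set_val @^-1` A).
  by apply: filterS filterT => a _; exact: set_valP.
have [p [Ap pF]] := cA (set_val @ F) _ FA.
exists (SigSub (mem_set Ap)); split=> // C D FC.
rewrite nbhsE => -[_ [[O oO <-] Op] OD].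
have FC' : F (set_val @^-1` (set_val @` C)).
  by apply: filterS FC; exact: preimage_image.
have [q [[c Cc <-] Oc]] := pF (set_val @` C) O FC' (open_nbhs_nbhs (conj oO Op)).
by exists c; split=> //; exact: OD.
Qed.

Section ClopenSeparating.
Variables (Y : topologicalType) (c : set nat -> Y -> bool).
Hypothesis Ycompact : compact [set: Y].
Hypothesis c_open : forall j b, open [set y | c j y = b].
Hypothesis c_inj : forall y z, (forall j, c j y = c j z) -> y = z.

Lemma separating_clopen j b : clopen [set y | c j y = b].
Proof.
split; first exact: c_open.
rewrite (_ : [set _ | _] = ~` [set y | c j y = ~~ b]); first exact: open_closedC.
by apply/seteqP; split=> y /=; case: (c j y); case: b.
Qed.

Lemma separating_zero_dimensional : zero_dimensional Y.
Proof.
move=> y z yz; have [j /eqP cyz] : exists j, c j y <> c j z.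
  apply: contrapT => nj; move/eqP: yz; apply; apply: c_inj => j.
  by apply: contrapT => cyz; apply: nj; exists j.
exists [set t | c j t = c j y]; split=> //; first exact: separating_clopen.
by move=> /esym/eqP; rewrite (negbTE cyz).
Qed.

Lemma separating_hausdorff : hausdorff_space Y.
Proof.
move=> y z yz; apply: contrapT => /eqP/separating_zero_dimensional[U [[oU cU] Uy nUz]].
have [|t []//] := yz U (~` U) (open_nbhs_nbhs (conj oU Uy)).
by apply: open_nbhs_nbhs; split=> //; exact: closed_openC.
Qed.

(** Compactness gives a finite clopen cover [K] refining [U]. The atoms of the Boolean algebra it
    generates are open, refine [U], and partition [Y], so each point lies in only one. *)
Lemma zero_dimensional_covdim : [set: Y] !=set0 -> covdim_zero Y.
Proof.
move=> Y0; split=> // U _ [oU UT].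
have clopenU y : exists C, [/\ clopen C, C y & exists2 A, U A & C `<=` A].
  have : (\bigcup_(A in U) A) y by rewrite UT.
  move=> [A UA Ay].
  have [|C [Cy cC] CA] := @zero_dimensional_cvg _ y separating_hausdorff
    separating_zero_dimensional Ycompact A.
    by apply: open_nbhs_nbhs; split=> //; exact: oU.
  by exists C; split=> //; exists A.
have [||K [/finite_seqP[K' KE] KU KT]] := finite_subcover
    (U := [set C | clopen C /\ exists2 A, U A & C `<=` A]) Ycompact.
- by move=> C [[]].
- by move=> y _; have [C [cC Cy CA]] := clopenU y; exists C.
pose cell x := [set y | forall C, C \in K' -> (if `[< C x >] then C else ~` C) y].
have cellE x y : cell x y -> cell y = cell x.
  move=> xy; have CE C : C \in K' -> `[< C y >] = `[< C x >].
    move=> CK; have := xy C CK; case: asboolP => Cx Cy; first exact: asboolT.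
    exact: asboolF.
  by apply/seteqP; split=> z xz C CK; have := xz C CK; rewrite CE.
have cellx x : cell x x by move=> C _; case: asboolP.
exists (range cell); split.
- split.
    move=> _ [x _ <-]; apply: open_seq_bigcap => C CK.
    have KC : K C by rewrite KE.
    have [[oC cC] _] := KU C KC.
    by case: asboolP => // _; exact: closed_openC.
  by apply/seteqP; split=> // x _; exists (cell x).
- move=> _ [x _ <-]; have [C KC Cx] := KT x I.
  have [_ [A UA CA]] := KU C KC; exists A => // y xy; apply: CA.
  by have := xy C; rewrite asboolT//; apply; move: KC; rewrite KE.
- move=> x; apply: (card_le_trans (B := [set cell x])).
    by apply: subset_card_le => _ [[y _ <-] yx]; rewrite /= (cellE y x).
  by have /card_eqPle[] := @card_set1 _ (cell x).
Qed.

(* [t] codes finitely many constraints: [decode t 0 = [set m]] gives their number,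
   [decode t k.+2] the coordinate of the [k]-th one and [k \in decode t 1] its
   value. *)
Definition box (t : set nat) : set Y :=
  [set y | forall k, k \in iota 0 (xget 0 (decode t 0)) ->
    c (decode t k.+2) y = `[< decode t 1 k >]].

(** Every point outside [U] differs from [y] in some coordinate. By compactness finitely many
    coordinates serve for all of them, and the box prescribing the values of [y] there lies in
    [U]. *)
Lemma basis_box : basis (range box).
Proof.
apply/basisP; split.
  by move=> _ [t _ <-]; apply: open_seq_bigcap => k _; exact: c_open.
move=> y U oU Uy.
have [|||V [/finite_seqP[V' VE] VU cover]] := finite_subcover (A := ~` U)
  (U := range (fun j => [set z | c j z = ~~ c j y])).
- by apply: (subclosed_compact _ Ycompact) => //; exact: open_closedC.
- by move=> _ [j _ <-].
- move=> z nUz; have [j cyz] : exists j, c j z <> c j y.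
    apply: contrapT => nj; apply: nUz; rewrite (_ : z = y)//; apply: c_inj => j.
    by apply: contrapT => cyz; apply: nj; exists j.
  exists [set z | c j z = ~~ c j y]; first by exists j.
  by move: cyz => /=; case: (c j z); case: (c j y).
have /choice[ind indP] A : exists j, A \in V' ->
    A = [set z | c j z = ~~ c j y].
  have [AV|nAV] := boolP (A \in V'); last by exists set0.
  by have [j _ <-] : range (fun j => [set z | c j z = ~~ c j y]) A;
    [apply: VU; rewrite VE|exists j].
pose s := [seq ind A | A <- V'].
have [t tE] := decode_surj (fun k => match k with
  | 0 => [set size s] | 1 => [set i | c (nth set0 s i) y] | k.+2 => nth set0 s k end).
have boxE : box t = [set z | forall j, j \in s -> c j z = c j y].
  rewrite /box tE (xget_unique 0 (_ : [set size s] (size s)))//.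
  apply/seteqP; split=> z /= zy.
    move=> j js; have := zy (index j s); rewrite mem_iota /= index_mem nth_index// asboolb.
    exact.
  by move=> k; rewrite mem_iota /= => ks; rewrite asboolb; apply: zy; exact: mem_nth.
exists (box t); rewrite boxE; split=> //; first by exists t.
move=> z zy; apply: contrapT => /cover[A]; rewrite VE /= => AV.
rewrite (indP A AV) /= zy; first by case: (c _ y).
exact: map_f.
Qed.
End ClopenSeparating.

(* CH does not compare [B] itself with the continuum; it is applied to a basis
   contained in [B] and squeezed between pairs of members of [range code].  If that one were
   countable, [f] would carry it to a countable basis of [X]. *)
Lemma card_le_basis (X Y : topologicalType) (f : Y -> X) (code : set nat -> set Y)
    (B : set (set Y)) :
  continuum_hypothesis -> compact [set: Y] -> hausdorff_space X ->
  (forall C : set (set X), basis C -> continuum #<= C) ->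
  continuous f -> set_surj [set: Y] [set: X] f ->
  basis (range code) -> basis B -> continuum #<= B.
Proof.
move=> CH cY hX wX cf sf /basisP[ocode codeP] /basisP[oB BP].
(* One member of [B] is picked for each pair of coded sets that has one in between. At most
   continuum many are picked, and by [B'P] they still form a basis. *)
have /choice[between betweenP] p : exists O, (exists O, [/\ B O,
    code (decode p 0) `<=` O & O `<=` code (decode p 1)]) ->
    [/\ B O, code (decode p 0) `<=` O & O `<=` code (decode p 1)].
  by have [[O OP]|nO] := pselect (exists O, [/\ B O,
    code (decode p 0) `<=` O & O `<=` code (decode p 1)]); [exists O|exists set0].
pose B' := B `&` range between.
apply: (card_le_trans (B := B')); last by apply: subset_card_le => O [].
have B'P y U : open U -> U y -> exists O, [/\ B' O, O y & O `<=` U].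
  move=> oU Uy; have [_ [[u _ <-] uy uU]] := codeP y U oU Uy.
  have [|O [BO Oy Ou]] := BP y (code u) _ uy; first by apply: ocode; exists u.
  have [_ [[t _ <-] ty tO]] := codeP y O (oB _ BO) Oy.
  have [p pE] := decode_surj (fun k => if k is 0 then t else u).
  have [|Bp tp pu] := betweenP p; first by rewrite pE; exists O.
  rewrite pE in tp pu; exists (between p); split.
  - by split; [|exists p].
  - exact: tp.
  - exact: subset_trans uU.
have /injfunPex[h _ hinj] : $|{injfun B' >-> continuum}|.
  apply/pcard_leP; apply: (card_le_trans (B := range between)).
    by apply: subset_card_le => O [].
  exact: card_image_le.
have hB' : h @` B' #= B' by exact: inj_card_eq.
have [hcount|/card_esym hcont] := CH (h @` B'); last first.
  by have /card_eqPle[] := card_eq_trans hcont hB'.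
exfalso; have B'count : countable B' by rewrite -(eq_countable hB').
(* [trace A] consists of the points whose whole fibre lies in the union of [A]. It is open because
   [f] maps the compact complement of that union onto a compact, hence closed, set. *)
pose trace (A : set (set Y)) := ~` (f @` ~` (\bigcup_(O in A) O)).
pose C := trace @` [set A | A `<=` B' /\ finite_set A].
apply: uncountable_continuum; apply: (sub_countable (B := C)).
  apply: wX; apply/basisP; split.
    move=> _ [A [AB' fA] <-]; apply: closed_openC; apply: compact_closed => //.
    apply: continuous_compact; first exact: continuous_subspaceT.
    apply: (subclosed_compact _ cY) => //; apply: open_closedC.
    by apply: bigcup_open => O /AB'[/oB].
  move=> x U oU Ux.
  (* The fibre over [x] is compact, so finitely many members of [B'] inside the preimage of [U]
     cover it. Their trace contains [x] and, [f] being onto, lies in [U]. *)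
  have [|||A [fA AB' cover]] := finite_subcover (A := f @^-1` [set x])
      (U := [set O | B' O /\ O `<=` f @^-1` U]).
  - apply: (subclosed_compact _ cY) => //; apply: preimage_closed => //.
    exact: accessible_closed_set1 (hausdorff_accessible hX) x.
  - by move=> O [[/oB]].
  - move=> y fy; have [||O [BO Oy OU]] := B'P y (f @^-1` U).
    + by move/continuousP: cf; exact.
    + by rewrite /preimage /= fy.
    + by exists O.
  exists (trace A); split.
  - by exists A => //; split=> // O /AB'[].
  - by move=> [y ny fy]; apply: ny; exact: cover.
  - move=> z nz; have [y _ fy] := sf z I.
    have [O AO Oy] : (\bigcup_(O in A) O) y.
      by apply: contrapT => ny; apply: nz; exists y.
    by have [_ OU] := AB' O AO; rewrite -fy; exact: OU.
apply: sub_countable (card_image_le _ _) _.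
exact: countable_finite_subset.
Qed.

(** * The resolution of a family of partitions *)

Lemma fst_continuous (T U : topologicalType) : continuous (@fst T U).
Proof. by move=> p; exact: cvg_fst. Qed.

Lemma snd_continuous (T U : topologicalType) : continuous (@snd T U).
Proof. by move=> p; exact: cvg_snd. Qed.

Lemma continuum_basis (X : topologicalType) (B : set (set X)) :
  [set: X] !=set0 -> basis B -> B #<= continuum ->
  exists g : set nat -> set X,
    forall x U, open U -> U x -> exists a, g a x /\ g a `<=` U.
Proof.
move=> [x0 _] /basisP[oB BP] /pfcard_geP[B0|[g]].
  by have [O [BO _ _]] := BP x0 setT openT I; rewrite B0 in BO.
exists g => x U oU Ux; have [O [BO Ox OU]] := BP x U oU Ux.
by have [a _ aO] := surj (f := g) BO; exists a; rewrite aO.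
Qed.

(** One separation is chosen for each pair of basic sets with disjoint closures, so that indices in
    [set nat] suffice; other pairs receive the empty separation. Distinct points have such basic
    neighbourhoods: separate them first, then shrink. *)
Lemma hausdorff_normal_basis_separation (X : topologicalType) (g : set nat -> set X) :
  hausdorff_space X -> normal_space X ->
  (forall x U, open U -> U x -> exists a, g a x /\ g a `<=` U) ->
  exists S : set nat -> set X * set X, (forall j, separation (S j)) /\
    forall x y, x <> y -> exists j, (S j).1 x /\ (S j).2 y.
Proof.
move=> hX nX gP.
have /choice[S SP] j : exists P : set X * set X, separation P /\
    (closure (g (decode j 0)) `&` closure (g (decode j 1)) = set0 ->
    g (decode j 0) `<=` P.1 /\ g (decode j 1) `<=` P.2).
  have [disj|ndisj] :=
    pselect (closure (g (decode j 0)) `&` closure (g (decode j 1)) = set0).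
    have [P [P1 P2 P0 gP1 gP2]] :=
      normal_separation nX (@closed_closure _ _) (@closed_closure _ _) disj.
    exists P; split=> // _.
    by split; [apply: subset_trans gP1|apply: subset_trans gP2]; exact: subset_closure.
  exists (set0, set0); split=> //; split=> /=; rewrite ?set0I//.
    by split; [exact: open0|apply: closed_Fsigma; exact: closed0].
  by split; [exact: open0|apply: closed_Fsigma; exact: closed0].
exists S; split; first by move=> j; have [] := SP j.
move=> x y /eqP xy; have cl (z : X) : closed [set z].
  exact: accessible_closed_set1 (hausdorff_accessible hX) z.
have [|P [[oP1 _] [oP2 _] P0 xP yP]] := normal_separation nX (cl x) (cl y).
  by apply/disjoints_subset => z -> /= xyE; move/eqP: xy; apply.
have [W [oW xW WP]] := normal_shrink nX (cl x) oP1 xP.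
have [W' [oW' yW' WP']] := normal_shrink nX (cl y) oP2 yP.
have [a [ax aW]] := gP x W oW (xW x erefl).
have [b [bx bW]] := gP y W' oW' (yW' y erefl).
have [j jE] := decode_surj (fun k => if k is 0 then a else b).
have [_] := SP j; rewrite jE => [[|S1 S2]]; last by exists j; split; [exact: S1|exact: S2].
apply/disjoints_subset => z /(closureS aW)/WP z1 /(closureS bW)/WP' z2.
by have : (P.1 `&` P.2) z by []; rewrite P0.
Qed.

Lemma finite_of_bounded_uniq (T : choiceType) (A : set T) n :
  (forall s : seq T, uniq s -> (forall a, a \in s -> A a) -> (size s <= n)%N) ->
  exists s : seq T, [/\ uniq s, (size s <= n)%N & forall a, A a -> a \in s].
Proof.
move=> An; have [finA|/(infinite_set_fset n.+1)[B BA nB]] := pselect (finite_set A).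
  have [s sE] := (finite_seqP A).1 finA.
  exists (undup s); split; first exact: undup_uniq.
    by apply: An => [|a]; [exact: undup_uniq|rewrite mem_undup sE].
  by move=> a; rewrite mem_undup sE.
by have := An (finmap.enum_fset B) (finmap.fset_uniq B) (fun a => BA a); rewrite leqNgt nB.
Qed.

Section Resolution.
Variables (X : topologicalType) (S : set nat -> set X * set X).
Hypothesis Xcompact : compact [set: X].
Hypothesis oS1 : forall j, open (S j).1.
Hypothesis oS2 : forall j, open (S j).2.
Hypothesis S0 : forall j, (S j).1 `&` (S j).2 = set0.
Hypothesis Ssep : forall x y, x <> y -> exists j, (S j).1 x /\ (S j).2 y.

Let Cube : topologicalType := prod_topology (fun _ : set nat => bool).

(* The point [(x, s)] records, for each partition [j], a side [s j] whose
   closed half contains [x]; only points outside both open halves have a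
   choice. *)
Definition resolution : set (X * Cube) :=
  [set p | forall j, if p.2 j then ~ (S j).2 p.1 else ~ (S j).1 p.1].

Definition side (j : set nat) (y : resolution) : bool := (set_val y).2 j.

Definition resolution_map (y : resolution) : X := (set_val y).1.

Lemma side_coordinate_open j b : open [set p : X * Cube | p.2 j = b].
Proof.
have -> : [set p : X * Cube | p.2 j = b] =
    (fun p : X * Cube => proj j p.2) @^-1` [set b] by [].
apply: open_comp; last exact: discrete_open.
move=> p _; apply: continuous_comp; first exact: snd_continuous.
exact: proj_continuous.
Qed.

Lemma closed_resolution : closed resolution.
Proof.
have -> : resolution = \bigcap_(j in [set: set nat]) ~` (
    ([set p | p.2 j = true] `&` fst @^-1` (S j).2) `|`
    ([set p | p.2 j = false] `&` fst @^-1` (S j).1)).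
  apply/seteqP; split=> p /= pS.
    by move=> j _ [|] [pj pSj]; have := pS j; rewrite pj; apply.
  by move=> j; case: ifP => pj pSj; apply: (pS j I); [left|right].
apply: closed_bigI => j _; apply: open_closedC.
by apply: openU; apply: openI; do ?exact: side_coordinate_open;
  apply: open_comp => // p _; exact: fst_continuous.
Qed.

Lemma compact_resolution : compact [set: resolution].
Proof.
apply: compact_set_type; apply: (subclosed_compact closed_resolution (B := setT)) => //.
rewrite -setXTT; apply: compact_setX => //.
have /tychonoff : forall j : set nat, compact [set: bool] by move=> j; exact: bool_compact.
by congr compact; apply/seteqP; split.
Qed.

Lemma side_open j b : open [set y | side j y = b].
Proof. by exists [set p | p.2 j = b]; first exact: side_coordinate_open. Qed.

Lemma resolution_map_continuous : continuous resolution_map.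
Proof.
move=> y; apply: (@continuous_comp _ _ _ set_val fst).
  exact: initial_continuous.
exact: fst_continuous.
Qed.

Lemma side_separates (j : set nat) (y : resolution) :
  if side j y then ~ (S j).2 (resolution_map y) else ~ (S j).1 (resolution_map y).
Proof. exact: (set_valP y). Qed.

Lemma resolution_eq (y z : resolution) :
  resolution_map y = resolution_map z -> (forall j, side j y = side j z) -> y = z.
Proof.
move=> yz1 yz2; apply: val_inj; move: yz1 yz2; rewrite /resolution_map /side !set_valE /=.
case: (val y) (val z) => [x s] [x' s'] /= -> ss'; congr pair.
exact/funext.
Qed.

(** If the points of [X] below [y] and [z] differed, some pair would have one in its first half and
    the other in its second, forcing opposite sides. *)
Lemma side_inj (y z : resolution) : (forall j, side j y = side j z) -> y = z.
Proof.
move=> yz; apply: resolution_eq => //; apply: contrapT => /Ssep[j [yj zj]].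
have := side_separates j y; have := side_separates j z; rewrite (yz j).
by case: (side j z) => // nz _; exact: nz.
Qed.

Lemma resolution_map_surj : set_surj [set: resolution] [set: X] resolution_map.
Proof.
(* The first side is chosen unless [x] lies in the second open half; disjointness of the halves
   makes this admissible. *)
move=> x _; pose s : Cube := fun j => `[< ~ (S j).2 x >].
have xs : resolution (x, s).
  move=> j; rewrite /s /=; case: asboolP => // /contrapT x2 x1.
  by have : ((S j).1 `&` (S j).2) x by []; rewrite S0.
by exists (SigSub (mem_set xs)).
Qed.

(** Off the partitions through [x] the side is forced, so a point of the fibre is determined by a
    Boolean function on at most [n] indices. *)
Lemma resolution_map_fiber n x :
  (forall s : seq (set nat), uniq s ->
    (forall j, j \in s -> ~ ((S j).1 `|` (S j).2) x) -> (size s <= n)%N) ->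
  resolution_map @^-1` [set x] #<= `I_(2 ^ n).
Proof.
move=> /(finite_of_bounded_uniq (A := [set j | ~ ((S j).1 `|` (S j).2) x]))[s [us sn sP]].
pose sides (y : resolution) := [ffun i : 'I_(size s) => side (nth set0 s i) y].
have cardS : #|{ffun 'I_(size s) -> bool}| = (2 ^ size s)%N.
  by rewrite card_ffun card_bool card_ord.
apply: (card_le_trans (B := `I_(2 ^ size s))); last by rewrite card_le_II leq_exp2l.
apply/pcard_leP/injfunPex.
exists (fun y => nat_of_ord (enum_rank (sides y))).
  by move=> y _ /=; rewrite -cardS.
move=> y z; rewrite !inE /= => yx zx /val_inj/enum_rank_inj yz.
apply: resolution_eq; first by rewrite yx zx.
move=> j; have [[x1|x2]|/sP js] := pselect (((S j).1 `|` (S j).2) x).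
- have := side_separates j y; have := side_separates j z; rewrite yx zx.
  by case: (side j y); case: (side j z).
- have := side_separates j y; have := side_separates j z; rewrite yx zx.
  by case: (side j y); case: (side j z).
- have ji : (index j s < size s)%N by rewrite index_mem.
  by have := congr1 (fun f : {ffun _ -> _} => f (Ordinal ji)) yz; rewrite !ffunE /= nth_index.
Qed.

End Resolution.

Theorem theorem4p1 (CH : continuum_hypothesis) (X : topologicalType) (n : nat)
    (Xcompact : compact [set: X]) (Xhausdorff : hausdorff_space X)
    (XF : F_space X) (Xweight : has_weight X continuum)
    (Xdim : has_covdim X n) :
  exists (Y : topologicalType) (f : Y -> X),
    [/\ compact [set: Y], hausdorff_space Y, covdim_zero Y &
        has_weight Y continuum] /\
    [/\ continuous f, set_surj [set: Y] [set: X] f &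
        forall x : X, f @^-1` [set x] #<= `I_(2 ^ n)].
Proof.
have [[B Bbasis /card_eqPle[BleC _]] Bmin] := Xweight.
have [X0 Xle _] := Xdim.
have Xnormal := compact_normal Xhausdorff Xcompact.
have [g gP] := continuum_basis X0 Bbasis BleC.
have [S0 [sepS0 S0P]] := hausdorff_normal_basis_separation Xhausdorff Xnormal gP.
have [lt [ltwf lttot ltcount]] := continuum_order CH.
(* As [decode] is surjective, taking it as the list of tasks schedules every tuple of [n.+1]
   distinct indices. *)
have [S [SP S0S Scover]] := open_pairs_of_small_order Xnormal XF Xle decode ltwf
  lttot ltcount sepS0.
have oS1 j : open (S j).1 by have [] := SP j.
have oS2 j : open (S j).2 by have [] := SP j.
have Sdisj j : (S j).1 `&` (S j).2 = set0 by have [] := SP j.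
have Ssep x y : x <> y -> exists j, (S j).1 x /\ (S j).2 y.
  move=> /S0P[j [x1 y2]]; have [le1 le2] := S0S j.
  by exists j; split; [exact: le1|exact: le2].
have cY : compact [set: resolution S] by exact: compact_resolution.
have oside : forall j b, open [set y : resolution S | side j y = b].
  exact: side_open.
have inj_side := side_inj Ssep.
have cf := @resolution_map_continuous _ S.
have sf := resolution_map_surj Sdisj.
have box_basis := basis_box cY oside inj_side.
exists (resolution S : topologicalType), (@resolution_map _ S); split; split.
- exact: cY.
- exact: separating_hausdorff oside inj_side.
- apply: (zero_dimensional_covdim cY oside inj_side).
  by have [x _] := X0; have [y _ _] := sf x I; exists y.
- have Ymin (C : set (set (resolution S))) : basis C -> continuum #<= C.
    exact: card_le_basis CH cY Xhausdorff Bmin cf sf box_basis.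
  split=> //; exists (range (box (@side _ S))) => //.
  rewrite card_eq_le Ymin// andbT; exact: card_image_le.
- exact: cf.
- exact: sf.
- move=> x; apply: resolution_map_fiber => s us sx.
  rewrite leqNgt; apply/negP => ns.
  (* The first [n.+1] entries of [s] form a scheduled tuple, so [x] lies in an open half of one of
     these partitions, against [sx]. *)
  have [t tE] := decode_surj (nth set0 s).
  have [|i ile xi] := Scover t _ x.
    move=> i k; rewrite !inE tE /= => il kl /eqP; rewrite nth_uniq//.
    + by move/eqP.
    + exact: leq_trans ns.
    + exact: leq_trans ns.
  by apply: sx xi; rewrite tE; apply: mem_nth; exact: leq_trans ns.
Qed.
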